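(* Let $\mathcal{D}\subset\mathbb{R}^d$ be bounded, let $s_0\in\mathcal{D}$ be a new location (not among the observed ones), let $\mathbb{P}_0$ (with expectation $\mathbb{E}_0$) be the law of the Matérn model with parameters $(\sigma_0^2,\phi_0,\tau_0^2)$ generating $y=(y(s_1),\ldots,y(s_n))^{T}$ and $y(s_0)=z(s_0)+\varepsilon(s_0)$, and let $\mathcal{M}_1,\ldots,\mathcal{M}_G$ be finitely many candidate conjugate Bayesian Matérn models. Let $w^*(y)=(w_1^*(y),\ldots,w_G^*(y))$ be stacking weights, i.e. (measurable) functions of the data $y$ such that, $\mathbb{P}_0$-almost surely, $$\sum_{g=1}^Gw_g^*(y)=1\quad\text{and}\quad w_g^*(y)\ge0\ \text{ for each }1\le g\le G.$$ Assume that for each model $\mathcal{M}_g$, $E^g_{1,n}:=\mathbb{E}_0\big(z(s_0)-\mathbb{E}_g(z(s_0)\mid y)\big)^2\to0$ as $n\to\infty$. For $1\le g\le G$ and $1\le i\le n$ let $$E^g_{1,n,i}:=\mathbb{E}_0\big(z(s_i)-\hat y_g(s_i)\big)^2,$$ where $\hat y_g(s_i)=\mathbb{E}_g(y(s_i)\mid y_{-i})$ is the leave-one-out Bayes predictor under $\mathcal{M}_g$, and assume that for each $1\le g\le G$ $$\frac1n\sum_{i=1}^nE^g_{1,n,i}\to0\quad\text{as }n\to\infty.$$ Then, as $n\to\infty$, $$\mathbb{E}_0\left(y(s_0)-\sum_{g=1}^Gw_g^*(y)\,\mathbb{E}_g(y(s_0)\mid y)\right)^2-\mathbb{E}_0\left(\frac1n\sum_{i=1}^n\Big(y(s_i)-\sum_{g=1}^Gw_g^*(y)\,\hat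 y_g(s_i)\Big)^2\right)\to0.$$
   Context: Matérn model with parameters $(\sigma^2,\phi,\tau^2)$ and smoothness $\nu>0$ (all positive): $y(s)=z(s)+\varepsilon(s)$, $s\in\mathcal{D}\subset\mathbb{R}^d$, where $z$ is a zero-mean Gaussian process with covariance $\sigma^2R_\Phi(s,s')$, $\Phi=(\phi,\nu)$, $\varepsilon$ is a Gaussian white noise process independent of $z$ (independent $\mathcal{N}(0,\tau^2)$ variables at distinct locations), and $$R_\Phi(s,s')=\frac{(\phi|s-s'|)^{\nu}}{\Gamma(\nu)2^{\nu-1}}K_\nu(\phi|s-s'|),\qquad R_\Phi(s,s)=1,$$ with $K_\nu$ the modified Bessel function of the second kind. The observed locations are $\chi=\{s_1,\ldots,s_n\}\subset\mathcal{D}$ (distinct). Candidate model $\mathcal{M}_g$: with fixed values $\Phi_g=(\phi_g,\nu_g)$ and $\delta_g^2>0$, given $\sigma^2$ the process $y(\cdot)$ follows the Matérn model with partial sill $\sigma^2$, correlation $R_{\Phi_g}$ and nugget $\delta_g^2\sigma^2$, and $\sigma^2\sim\mathrm{IG}(a_\sigma,b_\sigma)$ (inverse gamma, fixed $a_\sigma,b_\sigma>0$). $\mathbb{E}_g(\cdot\mid y)$ is the posterior (predictive) expectation given $y$ under $\mathcal{M}_g$; one has $\mathbb{E}_g(y(s_0)\mid y)=\mathbb{E}_g(z(s_0)\mid y)=J_g^{T}(\delta_g^2I_n+R_g)^{-1}y$ with $R_g=(R_{\Phi_g}(s_i,s_j))_{i,j}$ and $J_g=(R_{\Phi_g}(s_i,s_0))_i$.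 The vector $y_{-i}$ is $y$ with its $i$-th entry removed, and $\mathbb{E}_g(y(s_i)\mid y_{-i})$ is the posterior predictive mean of $y(s_i)$ under $\mathcal{M}_g$ given $y_{-i}$ (the same formula with $s_i$ in place of $s_0$ and $\chi\setminus\{s_i\}$ in place of $\chi$). The weights may depend on $n$; an example is $w^*(y)$ minimizing $\sum_{i=1}^n\big(y(s_i)-\sum_gw_g\hat y_g(s_i)\big)^2$ over the simplex. *)

(* Defs.v *)
From HB Require Import structures.
From mathcomp Require Import all_boot all_order all_algebra.
From mathcomp Require Import all_classical all_reals all_analysis.

Set Implicit Arguments.
Unset Strict Implicit.
Unset Printing Implicit Defensive.

Import Order.TTheory GRing.Theory Num.Theory.
Import numFieldNormedType.Exports.

Local Open Scope classical_set_scope.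
Local Open Scope ring_scope.

(* The norm that MathComp-Analysis puts on 'rV[R]_d is the sup norm; the Matern
   correlation is a function of the Euclidean distance. *)
Definition enorm (R : realType) (d : nat) (x : 'rV[R]_d) : R :=
  Num.sqrt (\sum_(k < d) x 0 k ^+ 2).

(* Euler's Gamma function, for a > 0. *)
Definition gammaf (R : realType) (a : R) : R :=
  \int[@lebesgue_measure R]_(t in `]0, +oo[) (t `^ (a - 1) * expR (- t)).

Definition cosh (R : realType) (t : R) : R := (expR t + expR (- t)) / 2.

(* Modified Bessel function of the second kind K_nu(x), for x > 0, by its
   classical integral representation
     K_nu(x) = int_0^oo exp(- x cosh t) cosh(nu t) dt. *)
Definition besselK (R : realType) (nu x : R) : R :=
  \int[@lebesgue_measure R]_(t in `[0, +oo[)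
     (expR (- (x * cosh t)) * cosh (nu * t)).

Definition matern_corr (R : realType) (d : nat) (phi nu : R)
    (s s' : 'rV[R]_d) : R :=
  if s == s' then 1 else
  let x := phi * enorm (s - s') in
  x `^ nu / (gammaf nu * 2 `^ (nu - 1)) * besselK nu x.

(* N(0, v).  The degenerate case v = 0 is separated because normal_prob 0 0 is
   not a point mass. *)
Definition centered_gauss (R : realType) (v : R) (B : set R) : \bar R :=
  if v == 0 then (\d_ (0 : R)) B else normal_prob 0 (Num.sqrt v) B.

(* z is, on D, a zero-mean Gaussian process with covariance function K under P:
   every finite linear combination of its values is Gaussian, with the mean and
   variance prescribed by K. *)
Definition gaussian_process (R : realType) (d : nat) (D : set 'rV[R]_d)
    (disp : measure_display) (T : measurableType disp)
    (P : {measure set T -> \bar R}) (z : 'rV[R]_d -> {mfun T >-> R})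
    (K : 'rV[R]_d -> 'rV[R]_d -> R) : Prop :=
  forall (m : nat) (t : 'I_m -> 'rV[R]_d) (c : 'I_m -> R),
    (forall i, D (t i)) ->
    forall B : set R, measurable B ->
      P [set w | B (\sum_(i < m) c i * z (t i) w)] =
      centered_gauss (\sum_(i < m) \sum_(j < m) c i * c j * K (t i) (t j)) B.

Definition white_noise (R : realType) (d : nat) (D : set 'rV[R]_d)
    (disp : measure_display) (T : measurableType disp)
    (P : {measure set T -> \bar R}) (eps : 'rV[R]_d -> {mfun T >-> R})
    (tau2 : R) : Prop :=
  forall (m : nat) (t : 'I_m -> 'rV[R]_d),
    (forall i, D (t i)) -> injective t ->
    forall B : 'I_m -> set R, (forall i, measurable (B i)) ->
      P [set w | forall i, B i (eps (t i) w)] =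
      (\prod_(i < m) normal_prob 0 (Num.sqrt tau2) (B i))%E.

Definition independent_processes (R : realType) (d : nat) (D : set 'rV[R]_d)
    (disp : measure_display) (T : measurableType disp)
    (P : {measure set T -> \bar R}) (z eps : 'rV[R]_d -> {mfun T >-> R}) : Prop :=
  forall (m k : nat) (t : 'I_m -> 'rV[R]_d) (u : 'I_k -> 'rV[R]_d),
    (forall i, D (t i)) -> (forall i, D (u i)) ->
    forall (A : set (m.-tuple R)) (B : set (k.-tuple R)),
      measurable A -> measurable B ->
      P [set w | A [tuple z (t i) w | i < m] /\ B [tuple eps (u i) w | i < k]] =
      (P [set w | A [tuple z (t i) w | i < m]] *
       P [set w | B [tuple eps (u i) w | i < k]])%E.

(* The observed process of the model is y(s) = z(s) + eps(s). *)
Record matern_model (R : realType) (d : nat) (D : set 'rV[R]_d)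
    (disp : measure_display) (T : measurableType disp)
    (P : {measure set T -> \bar R}) (z eps : 'rV[R]_d -> {mfun T >-> R})
    (sigma2 phi nu tau2 : R) : Prop := MaternModel {
  matern_latent :
    gaussian_process D P z (fun s s' => sigma2 * matern_corr phi nu s s') ;
  matern_noise : white_noise D P eps tau2 ;
  matern_indep : independent_processes D P z eps
}.

(* The conditional law of (z, eps) given that the partial sill equals v > 0 is
   cm_law v; the prior on the partial sill is IG(cm_a, cm_b). *)
Record conj_matern (R : realType) (d : nat) (D : set 'rV[R]_d) := ConjMatern {
  cm_phi : R ;
  cm_nu : R ;
  cm_delta2 : R ;
  cm_a : R ;
  cm_b : R ;
  cm_phi_gt0 : 0 < cm_phi ;
  cm_nu_gt0 : 0 < cm_nu ;
  cm_delta2_gt0 : 0 < cm_delta2 ;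
  cm_a_gt0 : 0 < cm_a ;
  cm_b_gt0 : 0 < cm_b ;
  cm_disp : measure_display ;
  cm_space : measurableType cm_disp ;
  cm_law : R.-pker (measurableTypeR R) ~> cm_space ;
  cm_z : 'rV[R]_d -> {mfun cm_space >-> R} ;
  cm_eps : 'rV[R]_d -> {mfun cm_space >-> R} ;
  cm_matern : forall v : R, 0 < v ->
    matern_model D (cm_law v) cm_z cm_eps v cm_phi cm_nu (cm_delta2 * v)
}.

(* Density of the inverse gamma distribution IG(a, b) at v > 0. *)
Definition invgamma_pdf (R : realType) (a b v : R) : R :=
  b `^ a / gammaf a * v `^ (- a - 1) * expR (- (b / v)).

Section Posterior.
Variables (R : realType) (d : nat) (D : set 'rV[R]_d) (M : conj_matern D).
Variables (n : nat) (s : 'I_n -> 'rV[R]_d).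
(* Only the observations y_j with obs j are conditioned upon. *)
Variables (obs : pred 'I_n) (y : n.-tuple R).

(* Density of the observations given the partial sill v and the latent process:
   y_j ~ N(z(s_j), delta^2 v), independently. *)
Definition likelihood (v : R) (w : cm_space M) : R :=
  \prod_(j < n | obs j)
    normal_pdf (cm_z M (s j) w) (Num.sqrt (cm_delta2 M * v)) (tnth y j).

Definition prior_int (X : cm_space M -> R) : \bar R :=
  (\int[@lebesgue_measure R]_(v in `]0%R, +oo[)
     ((invgamma_pdf (cm_a M) (cm_b M) v)%:E *
      \int[cm_law M v]_w (X w * likelihood v w)%:E))%E.

(* Posterior expectation of X given the observations, by Bayes' formula
   (posterior proportional to prior times likelihood).  It is meant for X a
   function of the latent process and of the noise at sites that are not
   conditioned upon: given v and the latent process, such noise is independent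
   of the observations, so that the likelihood above is the right one. *)
Definition posterior_mean (X : cm_space M -> R) : R :=
  fine (prior_int X) / fine (prior_int (cst 1)).

Definition posterior_z (s0 : 'rV[R]_d) : R :=
  posterior_mean (fun w => cm_z M s0 w).

Definition posterior_y (s0 : 'rV[R]_d) : R :=
  posterior_mean (fun w => cm_z M s0 w + cm_eps M s0 w).

End Posterior.

Definition loo_predictor (R : realType) (d : nat) (D : set 'rV[R]_d)
    (M : conj_matern D) (n : nat) (s : 'I_n -> 'rV[R]_d) (y : n.-tuple R)
    (i : 'I_n) : R :=
  posterior_y M s (predC1 i) y (s i).

(* Main.v *)
(** The posterior means of y(s_0) and z(s_0) agree, because given the partial
    sill the noise at s_0 is centred and independent of the likelihood.  Hence,
    with a the w-average of the errors z - p_g of the candidate predictors, the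
    prediction error of the stacked predictor p is y - p = e + a, where e is
    the noise, and a^2 <= sum_g (z - p_g)^2 has vanishing mean by assumption.
    For every t > 0,
      (e + a)^2 <= (1 + t) e^2 + (1 + 1/t) a^2  and
      e^2 <= (1 + t) (e + a)^2 + (1 + 1/t) a^2,
    so that both risks tend to the variance of the noise.  The dependence
    between the weights and the noise plays no role. *)

Require Import Defs.
From HB Require Import structures.
From mathcomp Require Import all_boot all_order all_algebra.
From mathcomp Require Import all_classical all_reals all_analysis.
From mathcomp Require Import measurable_realfun.
From mathcomp Require Import ring lra.

Import Order.TTheory GRing.Theory Num.Theory.
Import numFieldNormedType.Exports.

Local Open Scope classical_set_scope.
Local Open Scope ring_scope.

Set Implicit Arguments.
Unset Strict Implicit.
Unset Printing Implicit Defensive.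

(** * Normal random variables *)

Section normal.
Context {R : realType}.
Implicit Types (m s : R).
Local Notation mu := (@lebesgue_measure R).

(** The Radon-Nikodym derivative of the normal law agrees almost everywhere with [normal_pdf], since
    both have the same integral over every measurable set; the rest is a change of variables. *)
Lemma ge0_integral_normal_prob m s (f : R -> \bar R) :
  measurable_fun [set: R] f -> (forall x, (0 <= f x)%E) ->
  (\int[normal_prob m s]_x f x = \int[mu]_x (f x * (normal_pdf m s x)%:E))%E.
Proof.
move=> mf f0.
have dom := @normal_prob_dominates R m s.
have mpdf : measurable_fun setT (fun x => (normal_pdf m s x)%:E).
  by apply/measurable_EFinP; exact: measurable_normal_pdf.
rewrite -(Radon_Nikodym_SigmaFinite.change_of_variables dom)//.
have mRN := measurable_int _ (Radon_Nikodym_SigmaFinite.f_integrable dom).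
apply: ae_eq_integral => //; [exact: emeasurable_funM|exact: emeasurable_funM|].
apply: ae_eqe_mul2l; apply: integral_ae_eq => //.
  exact: Radon_Nikodym_SigmaFinite.f_integrable.
by move=> A _ mA; rewrite -Radon_Nikodym_SigmaFinite.f_integral.
Qed.

Lemma mulr_expRN_le1 (u : R) : u * expR (- u) <= 1.
Proof.
rewrite expRN -[leRHS](divff (lt0r_neq0 (expR_gt0 u))) ler_pM2r ?invr_gt0 ?expR_gt0//.
by apply: le_trans (expR_ge1Dx u); rewrite lerDr.
Qed.

(** Doubling the standard deviation frees a factor [expR (- u)] with u = 3 x^2 / (8 s^2), because
    1/2 = 3/8 + 1/8 in the exponent. This factor absorbs x^2 = (8/3) s^2 u, as
    [u * expR (- u) <= 1]. *)
Lemma sqr_normal_pdf_le s x : s != 0 ->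
  x ^+ 2 * normal_pdf 0 s x <=
  8 / 3 * s ^+ 2 * normal_peak s / normal_peak (2 * s) * normal_pdf 0 (2 * s) x.
Proof.
move=> s0; have s20 : 2 * s != 0 by rewrite mulf_neq0.
have p1 := normal_peak_gt0 s0; have p2 := normal_peak_gt0 s20.
rewrite !normal_pdfE//= /normal_fun subr0.
set u := 3 * x ^+ 2 / (8 * s ^+ 2).
have -> : - x ^+ 2 / (s ^+ 2 *+ 2) = - u + - x ^+ 2 / ((2 * s) ^+ 2 *+ 2).
  by rewrite /u; field.
have -> : x ^+ 2 = 8 / 3 * s ^+ 2 * u by rewrite /u; field.
rewrite expRD.
set e := expR (_ / _).
rewrite [leLHS](_ : _ = (8 / 3 * s ^+ 2 * normal_peak s * e) * (u * expR (- u))); last by ring.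
rewrite [leRHS](_ : _ = (8 / 3 * s ^+ 2 * normal_peak s * e) * 1); last first.
  by field; rewrite gt_eqF.
rewrite ler_wpM2l ?mulr_expRN_le1// mulr_ge0 ?expR_ge0//.
by rewrite mulr_ge0 ?(ltW p1)// mulr_ge0 ?sqr_ge0// divr_ge0.
Qed.

(** The integrand is dominated by a multiple of the density of standard deviation [2 * s], which has
    mass one. Finiteness is all that is used later; the variance is never evaluated. *)
Lemma normal_prob_sqr_lty s : s != 0 ->
  (\int[normal_prob 0 s]_x (x ^+ 2)%:E < +oo)%E.
Proof.
move=> s0; rewrite ge0_integral_normal_prob//; last 2 first.
- by apply/measurable_EFinP; exact: measurable_funX.
- by move=> x; rewrite lee_fin sqr_ge0.
set C := 8 / 3 * s ^+ 2 * normal_peak s / normal_peak (2 * s).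
have C0 : 0 <= C.
  rewrite divr_ge0 ?normal_peak_ge0// mulr_ge0 ?normal_peak_ge0//.
  by rewrite mulr_ge0 ?sqr_ge0// divr_ge0.
apply: (@le_lt_trans _ _ (\int[mu]_x (C%:E * (normal_pdf 0 (2 * s) x)%:E))%E).
  apply: ge0_le_integral => //.
  - by move=> x _; rewrite -EFinM lee_fin mulr_ge0 ?sqr_ge0 ?normal_pdf_ge0.
  - apply/measurable_EFinP; apply: measurable_funM; first exact: measurable_funX.
    exact: measurable_normal_pdf.
  - apply/measurable_EFinP; apply: measurable_funM => //.
    exact: measurable_normal_pdf.
  - by move=> x _; rewrite -!EFinM lee_fin sqr_normal_pdf_le.
rewrite ge0_integralZl_EFin//; last 2 first.
- by move=> x _; rewrite lee_fin normal_pdf_ge0.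
- by apply/measurable_EFinP; exact: measurable_normal_pdf.
by rewrite integral_normal_pdf mule1 ltry.
Qed.

Lemma ge0_integral_lebesgueN (f : R -> \bar R) :
  measurable_fun [set: R] f -> (forall x, (0 <= f x)%E) ->
  (\int[mu]_x f (- (x : R))%R = \int[mu]_x f x)%E.
Proof.
move=> mf f0.
pose opp : measurableTypeR R -> measurableTypeR R := -%R.
have mopp : measurable_fun [set: measurableTypeR R] opp by exact: oppr_measurable.
transitivity (\int[pushforward mu opp]_x f x)%E; last first.
  by apply: eq_measure_integral => A mA _; exact: lebesgue_measureN.
exact/esym/(ge0_integral_pushforward mopp mu measurableT mf).
Qed.

Lemma ge0_integral_normal_probN s (f : R -> \bar R) : s != 0 ->
  measurable_fun [set: R] f -> (forall x, (0 <= f x)%E) ->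
  (\int[normal_prob 0 s]_x f (- (x : R))%R = \int[normal_prob 0 s]_x f x)%E.
Proof.
move=> s0 mf f0.
have mfN : measurable_fun [set: R] (fun x => f (- x)) by exact: measurableT_comp.
pose g (x : R) : \bar R := (f x * (normal_pdf 0 s x)%:E)%E.
have mg : measurable_fun [set: R] g.
  apply: emeasurable_funM => //.
  by apply/measurable_EFinP; exact: measurable_normal_pdf.
have g0 x : (0 <= g x)%E by rewrite mule_ge0 ?f0// lee_fin normal_pdf_ge0.
rewrite (ge0_integral_normal_prob 0 s mfN (fun x => f0 (- x))).
rewrite (ge0_integral_normal_prob 0 s mf f0).
rewrite -(ge0_integral_lebesgueN mg g0).
apply: eq_integral => x _.
by rewrite /g !normal_pdfE//= /normal_fun !subr0 sqrrN.
Qed.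

End normal.

(** The law of the pair and the product of the two laws agree on rectangles, hence everywhere;
    Tonelli then separates the factors. *)
Lemma ge0_integralM_indep (R : realType) (disp : measure_display)
    (T : measurableType disp) (P : probability T R) (X Y : {mfun T >-> R})
    (f g : R -> \bar R) :
  (forall A B : set R, measurable A -> measurable B ->
     P [set w | A (X w) /\ B (Y w)] = (P (X @^-1` A) * P (Y @^-1` B))%E) ->
  measurable_fun [set: R] f -> (forall x, (0 <= f x)%E) ->
  measurable_fun [set: R] g -> (forall x, (0 <= g x)%E) ->
  (\int[P]_w (f (X w) * g (Y w)) =
   \int[P]_w f (X w) * \int[P]_w g (Y w))%E.
Proof.
move=> indep mf f0 mg g0.
pose XY (w : T) : R * R := (X w, Y w).
have mXY : measurable_fun [set: T] XY.
  have mX : measurable_fun [set: T] X by [].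
  have mY : measurable_fun [set: T] Y by [].
  exact: measurable_fun_pair mX mY.
pose h (p : R * R) := (f p.1 * g p.2)%E.
have mh : measurable_fun setT h.
  by apply: emeasurable_funM; apply: measurableT_comp.
have h0 p : (0 <= h p)%E by rewrite mule_ge0.
transitivity (\int[pushforward P XY]_p h p)%E.
  by rewrite (ge0_integral_pushforward mXY P measurableT mh).
transitivity (\int[(distribution P X \x distribution P Y)%E]_p h p)%E.
  apply: eq_measure_integral => A mA _; apply/esym.
  apply: (@product_measure_unique _ _ _ _ _ (distribution P X) (distribution P Y)
    (pushforward P XY)) => // B C mB mC.
rewrite (fubini_tonelli1 h mh h0) /fubini_F /h /=.
under eq_integral => x _.
  rewrite ge0_integralZl//; over.
rewrite ge0_integralZr//; last by apply: integral_ge0.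
rewrite (ge0_integral_distribution _ mf f0) (ge0_integral_distribution _ mg g0).
by [].
Qed.

(** * Random variables with a centred normal law *)

Section normal_rv.
Context {R : realType} {disp : measure_display} {T : measurableType disp}.
Variables (P : probability T R) (X : {mfun T >-> R}) (s : R).
Hypothesis s0 : s != 0.
Hypothesis lawX : forall B : set R, measurable B ->
  P (X @^-1` B) = normal_prob 0 s B.

Lemma ge0_integral_normal_rv (f : R -> \bar R) :
  measurable_fun [set: R] f -> (forall x, (0 <= f x)%E) ->
  (\int[P]_w f (X w) = \int[normal_prob 0 s]_x f x)%E.
Proof.
move=> mf f0.
pose X' : T -> measurableTypeR R := X.
have mX' : measurable_fun [set: T] X' by exact: (@measurable_funPT _ _ _ _ X).
transitivity (\int[pushforward P X']_x f x)%E.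
  by rewrite (ge0_integral_pushforward mX' P measurableT mf).
by apply: eq_measure_integral => A mA _; exact: lawX.
Qed.

Lemma integrable_normal_rv : P.-integrable setT (EFin \o X).
Proof.
have mX2 : measurable_fun [set: T] (fun w => (X w ^+ 2)%:E).
  by apply/measurable_EFinP/measurable_funX.
apply/integrableP; split; first exact/measurable_EFinP.
apply: (@le_lt_trans _ _ (\int[P]_w (1%:E + (X w ^+ 2)%:E))%E).
  apply: ge0_le_integral => //.
  - by apply: measurableT_comp => //; exact/measurable_EFinP.
  - by apply: emeasurable_funD.
  - move=> w _; rewrite -EFinD /= lee_fin.
    have := sqr_ge0 (`|X w| - 1); rewrite sqrrB1 real_normK ?num_real//.
    have := normr_ge0 (X w); lra.
rewrite ge0_integralD//; last by move=> w _; rewrite lee_fin sqr_ge0.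
rewrite integral_cst// mul1e [X in (X + _)%E]probability_setT.
rewrite (ge0_integral_normal_rv (f := fun x => (x ^+ 2)%:E)).
- by rewrite lte_add_pinfty ?ltry// normal_prob_sqr_lty.
- by apply/measurable_EFinP; exact: measurable_funX.
- by move=> x; rewrite lee_fin sqr_ge0.
Qed.

Lemma integrable_normal_rvM (L : {mfun T >-> R}) (C : R) :
  (forall w, `|L w| <= C) -> P.-integrable setT (fun w => (X w * L w)%:E).
Proof.
move=> LC; have := integrable_normal_rv => /(integrableZl measurableT C).
apply: le_integrable => //.
  by apply/measurable_EFinP; exact: measurable_funM.
move=> w _ /=; rewrite lee_fin !normrM mulrC ler_wpM2r//.
by rewrite (le_trans (LC w))// ler_norm.
Qed.

(** By independence the positive and negative parts of [X * L] have means E(L) E(max(X, 0)) and E(L)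
    E(max(-X, 0)), which coincide by symmetry of the normal law. *)
Lemma integral_normal_rvM_indep (L : {mfun T >-> R}) (C : R) :
  (forall w, `|L w| <= C) -> (forall w, 0 <= L w) ->
  (forall A B : set R, measurable A -> measurable B ->
     P [set w | A (L w) /\ B (X w)] = (P (L @^-1` A) * P (X @^-1` B))%E) ->
  (\int[P]_w (X w * L w)%:E = 0)%E.
Proof.
move=> LC L0 indep; have iXL := integrable_normal_rvM LC.
(* The absolute value makes the factor nonnegative on the whole line; it changes nothing on the
   values of [L]. *)
pose f (l : R) : \bar R := `|l|%:E.
pose g (x : R) : \bar R := (Num.max x 0)%:E.
have mf : measurable_fun [set: R] f.
  by apply/measurable_EFinP; exact: normr_measurable.
have f0 l : (0 <= f l)%E by rewrite lee_fin.
have mg : measurable_fun [set: R] g.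
  by apply/measurable_EFinP; exact: measurable_maxr.
have g0 x : (0 <= g x)%E by rewrite lee_fin le_max lexx orbT.
have mgN : measurable_fun [set: R] (fun x => g (- x)).
  exact: measurableT_comp.
have gN0 x : (0 <= g (- x)%R)%E by [].
have posE : (\int[P]_w ((fun w => (X w * L w)%:E)^\+ w) =
    \int[P]_w f (L w) * \int[normal_prob 0 s]_x g x)%E.
  rewrite -(ge0_integral_normal_rv mg g0).
  rewrite -(ge0_integralM_indep indep mf f0 mg g0).
  apply: eq_integral => w _; rewrite funeposE /f /g -EFinM ger0_norm//.
  by rewrite -EFin_max maxr_pMr// mulr0 mulrC.
have negE : (\int[P]_w ((fun w => (X w * L w)%:E)^\- w) =
    \int[P]_w f (L w) * \int[normal_prob 0 s]_x g x)%E.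
  rewrite -(ge0_integral_normal_probN s0 mg g0).
  rewrite -(ge0_integral_normal_rv mgN gN0).
  rewrite -(ge0_integralM_indep indep mf f0 mgN gN0).
  apply: eq_integral => w _; rewrite funenegE /f /g -EFinM ger0_norm//.
  by rewrite -EFin_max maxr_pMr// mulr0 mulrN mulrC.
(* Cancelling equal extended reals requires a finite one, which integrability of [X * L]
   supplies. *)
rewrite integralE posE negE subee// -posE.
by apply: integrable_fin_num => //; exact: integrable_funepos.
Qed.

End normal_rv.

(** * Measurability of the posterior mean *)

Section measurable_parametric_integral.
Context {R : realType} {dZ dX dY : measure_display}.
Context {Z : measurableType dZ} {X : measurableType dX} {Y : measurableType dY}.

(** The integral is by definition the difference of those of the positive and negative parts, so no
    integrability is involved. Composing with the second projection turns [k] into a kernel on the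
    product. *)
Lemma measurable_integral_pkernel (k : R.-pker X ~> Y)
    (f : (Z * X) * Y -> \bar R) : measurable_fun [set: (Z * X) * Y] f ->
  measurable_fun [set: Z * X] (fun p => \int[k p.2]_y f (p, y))%E.
Proof.
move=> mf.
have mkf (g : (Z * X) * Y -> \bar R) : measurable_fun [set: (Z * X) * Y] g ->
    (forall p, (0 <= g p)%E) ->
    measurable_fun [set: Z * X] (fun p => \int[k p.2]_y g (p, y))%E.
  by move=> mg g0; exact: (@measurable_kfcomp _ _ _ _ _ (kernel.kernel_snd k) _ mg g0).
rewrite (_ : (fun p => _) = (fun p : Z * X =>
    \int[k p.2]_y f^\+ (p, y) - \int[k p.2]_y f^\- (p, y))%E); last first.
  apply/funext => p; rewrite integralE.
  by congr (_ - _)%E; apply: eq_integral => y _; rewrite ?funeposE ?funenegE.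
apply: emeasurable_funB; apply: mkf => //.
- exact: measurable_funepos.
- exact: measurable_funeneg.
Qed.

(** The domain [E] becomes an indicator factor, and Tonelli measurability applies to the positive
    and negative parts. *)
Lemma measurable_integral_snd (mu : {sigma_finite_measure set X -> \bar R})
    (E : set X) (f : Z * X -> \bar R) :
  measurable E -> measurable_fun [set: Z * X] f ->
  measurable_fun [set: Z] (fun z => \int[mu]_(x in E) f (z, x))%E.
Proof.
move=> mE mf.
pose g (p : Z * X) := (f p * (\1_E p.2)%:E)%E.
have mg : measurable_fun [set: Z * X] g.
  apply: emeasurable_funM => //; apply/measurable_EFinP.
  by apply: measurableT_comp => //; exact: measurable_indic.
rewrite (_ : (fun z => _) = (fun z =>
    \int[mu]_x g^\+ (z, x) - \int[mu]_x g^\- (z, x))%E); last first.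
  apply/funext => z; rewrite integral_mkcond epatch_indic integralE.
  by congr (_ - _)%E; apply: eq_integral => y _; rewrite ?funeposE ?funenegE.
apply: emeasurable_funB.
- exact: (measurable_fun_fubini_tonelli_F _ (measurable_funepos mg)).
- exact: (measurable_fun_fubini_tonelli_F _ (measurable_funeneg mg)).
Qed.

End measurable_parametric_integral.

(** [powR] with a fixed exponent is measurable, and it inverts nonnegative numbers, hence the
    square. At 0 both sides vanish. *)
Lemma measurable_invr (R : realType) : measurable_fun [set: R] (@GRing.inv R).
Proof.
rewrite (_ : GRing.inv = fun x : R => x * (x ^+ 2) `^ (- 1)).
  apply: measurable_funM => //.
  apply: (measurableT_comp (measurable_powR _)); exact: measurable_funX.
apply/funext => x; rewrite powR_inv1 ?sqr_ge0//.
have [->|x0] := eqVneq x 0; first by rewrite invr0 mul0r.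
by rewrite expr2 invfM mulrA mulfV// mul1r.
Qed.

(* Unlike the left-hand side, the right-hand side is visibly measurable in
   [(m, u, x)], since the exponents of [powR] are constant. *)
Lemma normal_pdf_sqrtE (R : realType) (m u x : R) : 0 < u ->
  normal_pdf m (Num.sqrt u) x =
  (u * pi *+ 2) `^ (- 2^-1) * expR (- (x - m) ^+ 2 * (u *+ 2) `^ (- 1)).
Proof.
move=> u0; rewrite normal_pdfE ?gt_eqF ?sqrtr_gt0//.
rewrite /normal_peak /normal_fun sqr_sqrtr ?ltW//; congr (_ * _).
  by rewrite powRN powR12_sqrt// mulrn_wge0// mulr_ge0 ?pi_ge0// ltW.
by rewrite powR_inv1// mulrn_wge0// ltW.
Qed.

Section measurable_posterior.
Context {R : realType} {d : nat} {D : set 'rV[R]_d} (M : conj_matern D).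
Context {n : nat} (s : 'I_n -> 'rV[R]_d) (obs : pred 'I_n).
Local Notation mu := (@lebesgue_measure R).

(** The likelihood as a jointly measurable function of data, partial sill and latent process. It
    agrees with [likelihood] for positive sills, the only ones over which the prior is
    integrated. *)
Let lik (p : (n.-tuple R * R) * cm_space M) : R :=
  \prod_(j < n | obs j)
    ((cm_delta2 M * p.1.2 * pi *+ 2) `^ (- 2^-1) *
     expR (- (tnth p.1.1 j - cm_z M (s j) p.2) ^+ 2 *
             (cm_delta2 M * p.1.2 *+ 2) `^ (- 1))).

Let likE y v w : 0 < v -> likelihood s obs y v w = lik ((y, v), w).
Proof.
move=> v0; rewrite /likelihood /lik.
by apply: eq_bigr => j _; rewrite normal_pdf_sqrtE// mulr_gt0// cm_delta2_gt0.
Qed.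

Let measurable_lik : measurable_fun setT lik.
Proof.
rewrite /lik; under eq_fun do rewrite big_mkcond.
apply: measurable_prod => j _; case: (obs j) => //.
have mv : measurable_fun [set: (n.-tuple R * R) * cm_space M]
    (fun p => cm_delta2 M * p.1.2).
  apply: measurable_funM => //.
  exact: measurableT_comp measurable_snd measurable_fst.
apply: measurable_funM.
  apply: (measurableT_comp (measurable_powR _)).
  under eq_fun do rewrite -mulr_natr.
  by apply: measurable_funM => //; exact: measurable_funM.
apply: (measurableT_comp (@measurable_expR R)).
apply: measurable_funM; last first.
  apply: (measurableT_comp (measurable_powR _)).
  under eq_fun do rewrite -mulr_natr.
  exact: measurable_funM.
apply: (measurableT_comp (@oppr_measurable R setT)).
apply: measurable_funX; apply: measurable_funB.
  apply: (measurableT_comp (measurable_tnth j)).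
  exact: measurableT_comp measurable_fst measurable_fst.
exact: measurableT_comp (measurable_funPT (cm_z M (s j))) measurable_snd.
Qed.

Lemma measurable_likelihood (y : n.-tuple R) (v : R) : 0 < v ->
  measurable_fun setT (likelihood (M := M) s obs y v).
Proof.
move=> v0; rewrite (_ : likelihood _ _ _ _ = (fun w => lik ((y, v), w))).
  exact: (measurableT_comp measurable_lik (pair1_measurable (y, v))).
by apply/funext => w; rewrite likE.
Qed.

(** Numerator and denominator are iterated integrals depending on [y] as a parameter: first over the
    kernel [cm_law M], then over the partial sill. *)
Lemma measurable_posterior_mean (X : cm_space M -> R) :
  measurable_fun setT X ->
  measurable_fun [set: n.-tuple R] (fun y => posterior_mean s obs y X).
Proof.
move=> mX; suff mprior (Y : cm_space M -> R) : measurable_fun setT Y ->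
    measurable_fun [set: n.-tuple R] (fun y => prior_int s obs y Y).
  apply: measurable_funM.
    by apply: (measurableT_comp (@fine_measurable R setT _)) => //; exact: mprior.
  apply: (measurableT_comp (@measurable_invr R)).
  by apply: (measurableT_comp (@fine_measurable R setT _)) => //; exact: mprior.
move=> mY.
(* Equal to [invgamma_pdf] for [v > 0], with the quotient written as a power of constant
   exponent. *)
pose ig (v : R) : R := cm_b M `^ cm_a M / gammaf (cm_a M) *
  v `^ (- cm_a M - 1) * expR (- (cm_b M * v `^ (- 1))).
pose h (p : n.-tuple R * R) : \bar R :=
  ((ig p.2)%:E * \int[cm_law M p.2]_w (Y w * lik (p, w))%:E)%E.
rewrite (_ : (fun y => _) =
    (fun y => \int[mu]_(v in `]0%R, +oo[) h (y, v))%E); last first.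
  apply/funext => y; apply: eq_integral => v.
  rewrite inE/= in_itv/= andbT => v0; rewrite /h/=; congr (_%:E * _)%E.
    by rewrite /ig powR_inv1// ltW.
  by apply: eq_integral => w _; rewrite likE.
apply: measurable_integral_snd => //.
apply: emeasurable_funM.
  apply/measurable_EFinP; apply: (measurableT_comp _ measurable_snd).
  apply: measurable_funM; first exact: measurable_funM.
  apply: (measurableT_comp (@measurable_expR R)).
  apply: (measurableT_comp (@oppr_measurable R setT)).
  exact: measurable_funM.
apply: (@measurable_integral_pkernel _ _ _ _ _ _ _ (cm_law M)
  (fun q => (Y q.2 * lik q)%:E)).
apply/measurable_EFinP; apply: measurable_funM => //.
exact: measurableT_comp.
Qed.

End measurable_posterior.

(** * Posterior mean of the noise *)

Section probability_of_measure.
Context {disp : measure_display} {T : measurableType disp} {R : realType}.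
Variable P : {measure set T -> \bar R}.
Hypothesis P1 : P [set: T] = 1%E.

(* The dummy [let] lets the probability instance depend on [P1]. *)
Let P' : set T -> \bar R := let _ := P1 in P.

HB.instance Definition _ := Measure.on P'.
HB.instance Definition _ := Measure_isProbability.Build _ _ _ P' P1.

Definition probability_of_measure : probability T R := P'.

End probability_of_measure.

(** This exchange turns measurability in the point into measurability in the mean, the variable
    through which the latent process enters the likelihood. *)
Lemma normal_pdfC (R : realType) (m s x : R) : s != 0 ->
  normal_pdf m s x = normal_pdf x s m.
Proof. by move=> s0; rewrite !normal_pdfE// /normal_fun -sqrrN opprB. Qed.

Lemma gaussian_process_law (R : realType) (d : nat) (D : set 'rV[R]_d)
    (disp : measure_display) (T : measurableType disp)
    (P : {measure set T -> \bar R}) (z : 'rV[R]_d -> {mfun T >-> R}) K x :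
  gaussian_process D P z K -> D x -> K x x != 0 -> forall B, measurable B ->
  P (z x @^-1` B) = normal_prob 0 (Num.sqrt (K x x)) B.
Proof.
move=> gz Dx K0 B mB.
have := gz 1%N (fun=> x) (fun=> 1) (fun=> Dx) B mB.
rewrite !big_ord1 !mul1r /centered_gauss (negbTE K0) => <-.
by congr (P _); apply/funext => w; rewrite /= big_ord1 mul1r.
Qed.

Lemma white_noise_law (R : realType) (d : nat) (D : set 'rV[R]_d)
    (disp : measure_display) (T : measurableType disp)
    (P : {measure set T -> \bar R}) (eps : 'rV[R]_d -> {mfun T >-> R}) tau2 x :
  white_noise D P eps tau2 -> D x -> forall B, measurable B ->
  P (eps x @^-1` B) = normal_prob 0 (Num.sqrt tau2) B.
Proof.
move=> we Dx B mB.
have inj : injective (fun _ : 'I_1 => x) by move=> i j _; rewrite !ord1.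
have := we 1%N (fun=> x) (fun=> Dx) inj (fun=> B) (fun=> mB).
rewrite big_ord1 => <-; congr (P _); apply/funext => w.
by apply/propext; split => [Bw i //|/(_ ord0)].
Qed.

Section posterior_noise.
Context {R : realType} {d : nat} {D : set 'rV[R]_d} (M : conj_matern D).
Context {n : nat} (s : 'I_n -> 'rV[R]_d) (obs : pred 'I_n) (y : n.-tuple R).
Hypothesis Ds : forall i, D (s i).

Lemma likelihood_ge0 v w : 0 <= likelihood (M := M) s obs y v w.
Proof. by apply: prodr_ge0 => j _; exact: normal_pdf_ge0. Qed.

Lemma likelihood_le v w : 0 < v ->
  likelihood (M := M) s obs y v w <=
  \prod_(j < n | obs j) normal_peak (Num.sqrt (cm_delta2 M * v)).
Proof.
move=> v0; apply: ler_prod => j _; rewrite normal_pdf_ge0 normal_pdf_ub//.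
by rewrite gt_eqF// sqrtr_gt0 mulr_gt0// cm_delta2_gt0.
Qed.

(** Given [v], the likelihood is a bounded function of the latent values at the observed sites,
    hence independent of the centred noise at [s0], whose contribution is therefore zero.
    Boundedness also gives the integrability needed to split the sum. *)
Lemma integral_latent_noise_likelihood (v : R) (s0 : 'rV[R]_d) :
  0 < v -> D s0 ->
  (\int[cm_law M v]_w ((cm_z M s0 w + cm_eps M s0 w) *
     likelihood s obs y v w)%:E =
   \int[cm_law M v]_w (cm_z M s0 w * likelihood s obs y v w)%:E)%E.
Proof.
move=> v0 Ds0; have [gz we indep] := cm_matern M v0.
pose law : {measure set (cm_space M) -> \bar R} := cm_law M v.
have law1 : law [set: _] = 1%E by exact: prob_kernel.
pose P : probability (cm_space M) R := probability_of_measure law1.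
pose mL := isMeasurableFun.Build _ _ _ _ _ (measurable_likelihood (M := M) s obs y v0).
pose L : {mfun (cm_space M) >-> R} := HB.pack (likelihood (M := M) s obs y v) mL.
pose C := \prod_(j < n | obs j) normal_peak (Num.sqrt (cm_delta2 M * v)).
have LC w : `|L w| <= C by rewrite ger0_norm ?likelihood_ge0// likelihood_le.
have corr1 : v * matern_corr (cm_phi M) (cm_nu M) s0 s0 = v.
  by rewrite /matern_corr eqxx mulr1.
have lawz := gaussian_process_law gz Ds0.
rewrite corr1 in lawz.
have {}lawz := lawz (lt0r_neq0 v0).
have lawe := white_noise_law we Ds0.
have sv0 : Num.sqrt v != 0 by rewrite gt_eqF// sqrtr_gt0.
have se0 : Num.sqrt (cm_delta2 M * v) != 0.
  by rewrite gt_eqF// sqrtr_gt0 mulr_gt0// cm_delta2_gt0.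
have iz := integrable_normal_rvM (P := P) sv0 lawz LC.
have ie := integrable_normal_rvM (P := P) se0 lawe LC.
have e0 : (\int[P]_w (cm_eps M s0 w * L w)%:E = 0)%E.
  apply: (integral_normal_rvM_indep (P := P) se0 lawe LC) => [w|A B mA mB].
    exact: likelihood_ge0.
  (* The likelihood factors through the tuple of latent values, the form to which independence of
     the processes applies. *)
  pose Ly (t : n.-tuple R) := \prod_(j < n | obs j)
    normal_pdf (tnth t j) (Num.sqrt (cm_delta2 M * v)) (tnth y j).
  have mLy : measurable_fun [set: n.-tuple R] Ly.
    rewrite /Ly; under eq_fun do rewrite big_mkcond.
    apply: measurable_prod => j _; case: (obs j) => //.
    under eq_fun do rewrite normal_pdfC//.
    exact: measurableT_comp (measurable_normal_pdf _ _) (measurable_tnth j).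
  have LE w : likelihood (M := M) s obs y v w = Ly [tuple cm_z M (s i) w | i < n].
    by apply: eq_bigr => j _; rewrite tnth_mktuple.
  have mA' : measurable (Ly @^-1` A) by rewrite -[X in measurable X]setTI; exact: mLy.
  have mB' : measurable ((fun t : 1.-tuple R => tnth t ord0) @^-1` B).
    by rewrite -[X in measurable X]setTI; exact: measurable_tnth.
  have := indep n 1%N s (fun=> s0) Ds (fun=> Ds0) _ _ mA' mB'.
  rewrite (_ : [set w | _] = [set w | A (L w) /\ B (cm_eps M s0 w)]); last first.
    by apply/funext => w; rewrite /= LE tnth_mktuple.
  rewrite (_ : [set w | (Ly @^-1` A) _] = L @^-1` A); last first.
    by apply/funext => w; rewrite /= LE.
  rewrite (_ : [set w | _ [tuple cm_eps _ _ _ | _ < _]] = cm_eps M s0 @^-1` B)//.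
  by apply/funext => w; rewrite /= tnth_mktuple.
transitivity (\int[P]_w (cm_z M s0 w * L w)%:E +
              \int[P]_w (cm_eps M s0 w * L w)%:E)%E.
  rewrite -(integralD measurableT iz ie).
  by apply: eq_integral => w _; rewrite mulrDl EFinD.
by rewrite e0 adde0.
Qed.

Lemma posterior_yE (s0 : 'rV[R]_d) : D s0 ->
  posterior_y M s obs y s0 = posterior_z M s obs y s0.
Proof.
move=> Ds0; congr (fine _ / _); apply: eq_integral => v.
rewrite inE/= in_itv/= andbT => v0; congr (_ * _)%E.
exact: integral_latent_noise_likelihood.
Qed.

End posterior_noise.

(** * Stacking *)

(** Young's inequality. A small [t] keeps the coefficient of [x ^+ 2] close to 1, at the price of a
    large one on the term that will vanish. *)
Lemma sqrD_le (R : realFieldType) (t x a : R) : 0 < t ->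
  (x + a) ^+ 2 <= (1 + t) * x ^+ 2 + (1 + t^-1) * a ^+ 2.
Proof.
move=> t0; rewrite -subr_ge0.
rewrite (_ : _ - _ = (t * x - a) ^+ 2 / t); last by field; rewrite gt_eqF.
by rewrite divr_ge0 ?sqr_ge0// ltW.
Qed.

(** Jensen's inequality, read off from the nonnegativity of the weighted variance, followed by
    [w i <= 1]. The bound is free of the weights, so it can be integrated although they are
    random. *)
Lemma sqr_convex_sum_le (R : realFieldType) (I : finType) (w x : I -> R) :
  \sum_i w i = 1 -> (forall i, 0 <= w i) ->
  (\sum_i w i * x i) ^+ 2 <= \sum_i x i ^+ 2.
Proof.
move=> w1 w0; set m := \sum_i _.
have w_le1 i : w i <= 1.
  by rewrite -w1 (bigD1 i)//= lerDl sumr_ge0.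
apply: (@le_trans _ _ (\sum_i w i * x i ^+ 2)); last first.
  by apply: ler_sum => i _; rewrite ler_piMl ?sqr_ge0.
have : 0 <= \sum_i w i * (x i - m) ^+ 2.
  by apply: sumr_ge0 => i _; rewrite mulr_ge0 ?sqr_ge0.
rewrite (eq_bigr (fun i => w i * x i ^+ 2 + (w i * x i) * (- 2 * m) + w i * m ^+ 2));
  last by move=> i _; ring.
rewrite !big_split/= -!mulr_suml w1 -/m; lra.
Qed.

(** First [t] is fixed small, so that [t * c] is negligible; then [n] is taken large, so that
    [(1 + t^-1) * b n] is negligible too. *)
Lemma cvge_sandwich_sqrD (R : realType) (h b : (\bar R)^nat) (c : R) :
  0 <= c -> (forall n, (0 <= h n)%E) -> (forall n, (0 <= b n)%E) ->
  b n @[n --> \oo] --> (0 : \bar R)%E ->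
  (\forall n \near \oo, forall t : R, 0 < t ->
    (h n <= (1 + t)%:E * c%:E + (1 + t^-1)%:E * b n)%E /\
    (c%:E <= (1 + t)%:E * h n + (1 + t^-1)%:E * b n)%E) ->
  h n @[n --> \oo] --> c%:E.
Proof.
move=> c0 h0 b0 /fine_cvgP[bfin bcvg] hb.
have hfin : \forall n \near \oo, h n \is a fin_num.
  near=> n; have bn : b n \is a fin_num by near: n.
  have hbn : forall t : R, 0 < t ->
    (h n <= (1 + t)%:E * c%:E + (1 + t^-1)%:E * b n)%E /\
    (c%:E <= (1 + t)%:E * h n + (1 + t^-1)%:E * b n)%E by near: n.
  (* Any positive [t] would do here; only finiteness of the bound is wanted. *)
  have [hle _] := hbn 1 ltr01.
  rewrite ge0_fin_numE//; apply: le_lt_trans hle _.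
  by rewrite -(fineK bn) -!EFinM -EFinD ltry.
apply/fine_cvgP; split => //.
apply/cvgrPdist_le => e e0.
(* This gives [t * c <= e / 4]; [c + 1] avoids a division by zero when [c = 0]. *)
pose t := Num.min 1 (e / (4 * (c + 1))).
have t0 : 0 < t by rewrite lt_min ltr01/= divr_gt0// mulr_gt0// ltr_wpDl.
have t1 : t <= 1 by rewrite ge_min lexx.
have tc : t * (4 * (c + 1)) <= e.
  by rewrite -ler_pdivlMr ?mulr_gt0 ?ltr_wpDl// ge_min lexx orbT.
pose K := 1 + t^-1.
have K0 : 0 < K by rewrite addr_gt0// invr_gt0.
near=> n.
have bn : b n \is a fin_num by near: n.
have hn : h n \is a fin_num by near: n.
have bs : `|0 - fine (b n)| <= e / (4 * K).
  near: n; apply: (cvgrPdist_le _ _).1 => //=.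
  by rewrite divr_gt0// mulr_gt0.
have hbn : forall t : R, 0 < t ->
    (h n <= (1 + t)%:E * c%:E + (1 + t^-1)%:E * b n)%E /\
    (c%:E <= (1 + t)%:E * h n + (1 + t^-1)%:E * b n)%E by near: n.
have [] := hbn t t0; rewrite -/K -(fineK bn) -(fineK hn) -!EFinM -!EFinD !lee_fin.
move: bs; rewrite sub0r normrN ger0_norm ?fine_ge0// ler_pdivlMr ?mulr_gt0//.
have := fine_ge0 (b0 n); have := fine_ge0 (h0 n); rewrite /=.
move: (fine (h n)) (fine (b n)) => x y x0 y0 yK hle cle.
(* In the lower bound for [x], the term [t * x] is controlled by the upper bound: it is at most 2 t
   c + K y. So c - x is at most 2 t c + 2 K y, which is at most [e]. *)
have tx : t * x <= t * ((1 + t) * c + K * y) by rewrite ler_wpM2l// ltW.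
have ttc : t * (t * c) <= t * c by rewrite ler_piMl// mulr_ge0// ltW.
have tKy : t * (K * y) <= K * y by rewrite ler_piMl// mulr_ge0// ltW.
have tc0 : 0 <= t * c by rewrite mulr_ge0// ltW.
have t0' := ltW t0.
rewrite ler_norml; apply/andP; split; lra.
Unshelve. all: by end_near. Qed.

(** Nonnegativity replaces integrability, so infinite expectations are allowed. The inequality is
    only almost sure because the weights lie in the simplex only almost surely. *)
Lemma expectation_le_lincomb (R : realType) (disp : measure_display)
    (T : measurableType disp) (P : probability T R) (f g h : T -> R) (a b : R) :
  measurable_fun setT f -> measurable_fun setT g -> measurable_fun setT h ->
  (forall w, 0 <= f w) -> (forall w, 0 <= g w) -> (forall w, 0 <= h w) ->
  0 <= a -> 0 <= b -> {ae P, forall w, f w <= a * g w + b * h w} ->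
  ('E_P[f] <= a%:E * 'E_P[g] + b%:E * 'E_P[h])%E.
Proof.
move=> mf mg mh f0 g0 h0 a0 b0 fgh.
apply: (@le_trans _ _ ('E_P[(fun w => a * g w + b * h w)%R])%E).
  apply: expectation_le => //.
    by apply: measurable_funD; exact: measurable_funM.
  by move=> w; rewrite addr_ge0// mulr_ge0.
rewrite unlock; under eq_integral do rewrite EFinD !EFinM.
rewrite ge0_integralD//.
- by rewrite !ge0_integralZl_EFin//;
    try (by move=> w _; rewrite lee_fin); exact/measurable_EFinP.
- by move=> w _; rewrite -EFinM lee_fin mulr_ge0.
- by apply/measurable_EFinP; exact: measurable_funM.
- by move=> w _; rewrite -EFinM lee_fin mulr_ge0.
- by apply/measurable_EFinP; exact: measurable_funM.
Qed.

Lemma expectation_mean (R : realType) (disp : measure_display)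
    (T : measurableType disp) (P : probability T R) (m : nat)
    (f : 'I_m -> T -> R) :
  (forall i, measurable_fun setT (f i)) -> (forall i om, 0 <= f i om) ->
  ('E_P[fun om => (m%:R^-1 * \sum_(i < m) f i om)%R] =
   (m%:R^-1)%:E * \sum_(i < m) 'E_P[f i])%E.
Proof.
move=> mf f0; rewrite unlock; under eq_integral do rewrite EFinM -sumEFin.
rewrite ge0_integralZl_EFin//; last 2 first.
- by move=> om _; rewrite sume_ge0// => i _; rewrite lee_fin.
- by apply: emeasurable_sum => i; exact/measurable_EFinP.
rewrite ge0_integral_sum// => i; first exact/measurable_EFinP.
by move=> om _; rewrite lee_fin.
Qed.

(* With [k n = 1] the [k n] sites are the new location alone, with [k n = n]
   they are the observed ones. *)
Section stacking.
Context {R : realType} {disp : measure_display} {T : measurableType disp}.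
Variable P : probability T R.
Variables (G : nat) (k : nat -> nat).
Variables (y z e : forall n : nat, 'I_(k n) -> T -> R).
Variables (p : forall n : nat, 'I_G -> 'I_(k n) -> T -> R).
Variables (w : forall n : nat, 'I_G -> T -> R) (c : R).
Arguments y : clear implicits.
Arguments z : clear implicits.
Arguments e : clear implicits.
Arguments p : clear implicits.
Hypothesis k_gt0 : \forall n \near \oo, (0 < k n)%N.
Hypothesis yE : forall n i om, y n i om = z n i om + e n i om.
Hypothesis mz : forall n i, measurable_fun setT (z n i).
Hypothesis me : forall n i, measurable_fun setT (e n i).
Hypothesis mp : forall n g i, measurable_fun setT (p n g i).
Hypothesis mw : forall n g, measurable_fun setT (w n g).
Hypothesis Ee : forall n i, ('E_P[fun om => (e n i om ^+ 2)%R] = c%:E)%E.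
Hypothesis w_simplex : forall n, {ae P, forall om,
  \sum_(g < G) w n g om = 1 /\ forall g, 0 <= w n g om}.
Hypothesis p_cvg : forall g : 'I_G,
  (((k n)%:R^-1)%:E *
     \sum_(i < k n) 'E_P[fun om => ((z n i om - p n g i om) ^+ 2)%R])%E
  @[n --> \oo] --> (0 : \bar R)%E.

Let risk n om :=
  (k n)%:R^-1 * \sum_(i < k n) (y n i om - \sum_(g < G) w n g om * p n g i om) ^+ 2.
Let noise n om := (k n)%:R^-1 * \sum_(i < k n) e n i om ^+ 2.
Let err n om :=
  (k n)%:R^-1 * \sum_(i < k n) \sum_(g < G) (z n i om - p n g i om) ^+ 2.

Let risk_bounds n om (t : R) : 0 < t ->
  \sum_(g < G) w n g om = 1 -> (forall g, 0 <= w n g om) ->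
  risk n om <= (1 + t) * noise n om + (1 + t^-1) * err n om /\
  noise n om <= (1 + t) * risk n om + (1 + t^-1) * err n om.
Proof.
move=> t0 w1 w0; have t1 : 0 <= 1 + t^-1 by rewrite addr_ge0// invr_ge0 ltW.
pose a i := \sum_(g < G) w n g om * (z n i om - p n g i om).
have a2 i : (1 + t^-1) * a i ^+ 2 <=
    (1 + t^-1) * \sum_(g < G) (z n i om - p n g i om) ^+ 2.
  by rewrite ler_wpM2l// sqr_convex_sum_le.
(* Since the weights sum to one, [z] can be moved inside the weighted sum. *)
have resE i : y n i om - \sum_(g < G) w n g om * p n g i om = e n i om + a i.
  rewrite /a; under [X in _ = _ + X]eq_bigr do rewrite mulrBr.
  by rewrite sumrB -mulr_suml w1 mul1r yE; ring.
have ki0 : 0 <= (k n)%:R^-1 :> R by rewrite invr_ge0.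
rewrite /risk /noise /err; split;
  rewrite !(mulrCA (1 + _)) -mulrDr ler_wpM2l// !mulr_sumr -big_split/=;
  apply: ler_sum => i _; apply: le_trans (lerD (lexx _) (a2 i)).
  by rewrite resE sqrD_le.
(* Here the noise is written as [(e + a) - a]. *)
by rewrite resE -{1}(addrK (a i) (e n i om)) -(sqrrN (a i)) sqrD_le.
Qed.

Let measurable_risk n : measurable_fun setT (risk n).
Proof.
apply: measurable_funM => //; apply: measurable_sum => i.
apply: measurable_funX; apply: measurable_funB.
  rewrite (_ : y n i = fun om => z n i om + e n i om).
    exact: measurable_funD.
  by apply/funext => om; rewrite yE.
by apply: measurable_sum => g; exact: measurable_funM.
Qed.

Let measurable_noise n : measurable_fun setT (noise n).
Proof.
apply: measurable_funM => //; apply: measurable_sum => i.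
exact: measurable_funX.
Qed.

Let measurable_err1 n i g :
  measurable_fun setT (fun om => (z n i om - p n g i om) ^+ 2).
Proof. by apply: measurable_funX; exact: measurable_funB. Qed.

Let measurable_err n : measurable_fun setT (err n).
Proof.
apply: measurable_funM => //; apply: measurable_sum => i.
by apply: measurable_sum => g; exact: measurable_err1.
Qed.

Let mean_sqr_ge0 n (f : 'I_(k n) -> R) : (forall i, 0 <= f i) ->
  0 <= (k n)%:R^-1 * \sum_i f i.
Proof. by move=> f0; rewrite mulr_ge0 ?invr_ge0// sumr_ge0. Qed.

Let risk_ge0 n om : 0 <= risk n om.
Proof. by apply: mean_sqr_ge0 => i; rewrite sqr_ge0. Qed.

Let noise_ge0 n om : 0 <= noise n om.
Proof. by apply: mean_sqr_ge0 => i; rewrite sqr_ge0. Qed.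

Let err_ge0 n om : 0 <= err n om.
Proof. by apply: mean_sqr_ge0 => i; rewrite sumr_ge0// => g _; rewrite sqr_ge0. Qed.

(** With no site the average would be 0 instead of [c], hence the positivity of [k n]. *)
Let expectation_noise n : (0 < k n)%N -> ('E_P[noise n] = c%:E)%E.
Proof.
move=> kn0; rewrite /noise expectation_mean//; last 2 first.
- by move=> i; exact: measurable_funX.
- by move=> i om; rewrite sqr_ge0.
under eq_bigr do rewrite Ee.
rewrite sumEFin sumr_const card_ord -EFinM -(mulr_natl c) mulrA mulVf ?mul1r//.
by rewrite pnatr_eq0 -lt0n.
Qed.

Let err_cvg : ('E_P[err n])%E @[n --> \oo] --> (0 : \bar R)%E.
Proof.
have Eerr n : ('E_P[err n] = \sum_(g < G) ((k n)%:R^-1)%:E *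
    \sum_(i < k n) 'E_P[fun om => ((z n i om - p n g i om) ^+ 2)%R])%E.
  rewrite [LHS]expectation_mean; last 2 first.
  - by move=> i; apply: measurable_sum => g; exact: measurable_err1.
  - by move=> i om; rewrite sumr_ge0// => g _; rewrite sqr_ge0.
  rewrite -ge0_sume_distrr; last first.
    move=> g _; apply: sume_ge0 => i _; apply: expectation_ge0 => om.
    exact: sqr_ge0.
  rewrite exchange_big/=; congr (_ * _)%E; apply: eq_bigr => i _.
  rewrite unlock; under eq_integral do rewrite -sumEFin.
  rewrite ge0_integral_sum// => g; first exact/measurable_EFinP.
  by move=> om _; rewrite lee_fin sqr_ge0.
under eq_fun do rewrite Eerr.
have E0 : (\sum_(g < G) (0 : \bar R) = 0)%E by rewrite big1.
have f0 (g : 'I_G) : xpredT g -> \forall n \near \oo, (0 <= ((k n)%:R^-1)%:E *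
    \sum_(i < k n) 'E_P[fun om => ((z n i om - p n g i om) ^+ 2)%R])%E.
  move=> _; apply: nearW => n; rewrite mule_ge0 ?lee_fin ?invr_ge0//.
  apply: sume_ge0 => i _; apply: expectation_ge0 => om; exact: sqr_ge0.
have := @cvg_nnesum _ _ _ _ _ (index_enum 'I_G) _ _ xpredT f0 (fun g _ => p_cvg g).
by move=> /(_ eventually_filter); rewrite E0.
Qed.

Lemma expectation_risk_cvg :
  ('E_P[fun om => ((k n)%:R^-1 * \sum_(i < k n)
      (y n i om - \sum_(g < G) w n g om * p n g i om) ^+ 2)%R])%E
  @[n --> \oo] --> c%:E.
Proof.
apply: (@cvge_sandwich_sqrD _ (fun n => 'E_P[risk n])%E (fun n => 'E_P[err n])%E) => //.
(* The sign of [c] is read off at any [n] with a nonempty set of sites, where [c] is the mean of a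
   nonnegative variable. *)
- near \oo => n; have kn0 : (0 < k n)%N by near: n.
  by rewrite -lee_fin -(expectation_noise kn0) expectation_ge0.
- by move=> n; exact: expectation_ge0.
- by move=> n; exact: expectation_ge0.
near=> n => t t0; have kn0 : (0 < k n)%N by near: n.
have t1 : 0 <= 1 + t by rewrite addr_ge0// ltW.
have ti1 : 0 <= 1 + t^-1 by rewrite addr_ge0// invr_ge0 ltW.
rewrite -(expectation_noise kn0).
split; apply: expectation_le_lincomb => //.
  by apply: filterS (w_simplex n) => om [w1 w0]; have [] := risk_bounds t0 w1 w0.
by apply: filterS (w_simplex n) => om [w1 w0]; have [] := risk_bounds t0 w1 w0.
Unshelve. all: by end_near. Qed.

End stacking.

(** * The stacked risks at the new location and at the observed ones *)

Theorem theorem3p4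
  (R : realType) (d : nat) (D : set 'rV[R]_d)
  (D_bounded : exists r : R, forall s, D s -> enorm s <= r)
  (s0 : 'rV[R]_d) (Ds0 : D s0)
  (s : forall n : nat, 'I_n -> 'rV[R]_d)
  (Ds : forall n i, D (s n i))
  (s_distinct : forall n, injective (s n))
  (s0_new : forall n i, s n i <> s0)
  (disp : measure_display) (T : measurableType disp) (P0 : probability T R)
  (z eps : 'rV[R]_d -> {mfun T >-> R})
  (sigma2 phi nu tau2 : R)
  (sigma2_gt0 : 0 < sigma2) (phi_gt0 : 0 < phi)
  (nu_gt0 : 0 < nu) (tau2_gt0 : 0 < tau2)
  (P0_matern : matern_model D P0 z eps sigma2 phi nu tau2)
  (G : nat) (M : 'I_G -> conj_matern D)
  (wt : forall n : nat, 'I_G -> n.-tuple R -> R)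
  (wt_measurable : forall n g, measurable_fun setT (wt n g)) :
  let yy (x : 'rV[R]_d) (om : T) : R := z x om + eps x om in
  let yobs (n : nat) (om : T) : n.-tuple R := [tuple yy (s n i) om | i < n] in
  let yhat (n : nat) (g : 'I_G) (i : 'I_n) (om : T) : R :=
    loo_predictor (M g) (s n) (yobs n om) i in
  let E1 (g : 'I_G) (n : nat) : \bar R :=
    'E_P0[fun om : T =>
      ((z s0 om - posterior_z (M g) (s n) predT (yobs n om) s0) ^+ 2)%R]%E in
  let E1loo (g : 'I_G) (n : nat) (i : 'I_n) : \bar R :=
    'E_P0[fun om : T => ((z (s n i) om - yhat n g i om) ^+ 2)%R]%E in
  (forall n, {ae P0, forall om,
     \sum_(g < G) wt n g (yobs n om) = 1 /\
     forall g : 'I_G, 0 <= wt n g (yobs n om)}) ->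
  (forall g : 'I_G, E1 g n @[n --> \oo] --> (0 : \bar R)%E) ->
  (forall g : 'I_G,
     ((n%:R^-1)%:E * \sum_(i < n) E1loo g n i)%E @[n --> \oo]
       --> (0 : \bar R)%E) ->
  ('E_P0[fun om : T =>
       ((yy s0 om - \sum_(g < G) wt n g (yobs n om) *
          posterior_y (M g) (s n) predT (yobs n om) s0) ^+ 2)%R] -
   'E_P0[fun om : T =>
       (n%:R^-1 * \sum_(i < n)
         (yy (s n i) om - \sum_(g < G) wt n g (yobs n om) *
            yhat n g i om) ^+ 2)%R])%E @[n --> \oo]
    --> (0 : \bar R)%E.
Proof.
move=> yy yobs yhat E1 E1loo w_simplex E1_cvg E1loo_cvg.
have [_ noise_law _] := P0_matern.
have st0 : Num.sqrt tau2 != 0 by rewrite gt_eqF// sqrtr_gt0.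
(* The noise variance, left as an integral: only its finiteness and its being the same at every site
   matter. *)
pose c := fine (\int[normal_prob 0 (Num.sqrt tau2)]_x (x ^+ 2)%:E)%E.
have Eeps x : D x -> ('E_P0[fun om => (eps x om ^+ 2)%R] = c%:E)%E.
  move=> Dx; rewrite unlock.
  rewrite (ge0_integral_normal_rv (white_noise_law noise_law Dx)
    (f := fun x => (x ^+ 2)%:E)).
  - rewrite fineK// ge0_fin_numE ?normal_prob_sqr_lty//.
    by apply: integral_ge0 => ? _; rewrite lee_fin sqr_ge0.
  - by apply/measurable_EFinP; exact: measurable_funX.
  - by move=> ?; rewrite lee_fin sqr_ge0.
have myy x : measurable_fun setT (yy x) by exact: measurable_funD.
have myobs n : measurable_fun setT (yobs n).
  apply/measurable_fun_tnthP => i.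
  rewrite (_ : _ \o _ = yy (s n i)) //.
  by apply/funext => om; rewrite /= tnth_mktuple.
have mpost n g (obs : pred 'I_n) x :
    measurable_fun setT (fun om => posterior_y (M g) (s n) obs (yobs n om) x).
  apply: (measurableT_comp (measurable_posterior_mean _ _ _) (myobs n)).
  exact: measurable_funD.
have mwt n g : measurable_fun [set: T] (fun om => wt n g (yobs n om)).
  exact: measurableT_comp (wt_measurable n g) (myobs n).
have new_cvg := @expectation_risk_cvg R disp T P0 G (fun=> 1%N)
  (fun n _ => yy s0) (fun n _ => z s0) (fun n _ => eps s0)
  (fun n g _ om => posterior_y (M g) (s n) predT (yobs n om) s0)
  (fun n g om => wt n g (yobs n om)) c.
have loo_cvg := @expectation_risk_cvg R disp T P0 G id
  (fun n i => yy (s n i)) (fun n i => z (s n i)) (fun n i => eps (s n i))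
  yhat (fun n g om => wt n g (yobs n om)) c.
(* Both risks tend to the same finite [c], so the difference of the limits is well defined and
   zero. *)
rewrite -(subee (x := c%:E))//; apply: cvgeB => //; last first.
  apply: loo_cvg => //.
  - by move=> n g i; exact: mpost.
  - by move=> n i; exact: Eeps.
rewrite (_ : (fun n => _) = (fun n => 'E_P0[fun om => (1%:R^-1 * \sum_(i < 1)
    (yy s0 om - \sum_(g < G) wt n g (yobs n om) *
       posterior_y (M g) (s n) predT (yobs n om) s0) ^+ 2)%R])%E); last first.
  apply/funext => n; congr expectation; apply/funext => om.
  by rewrite big_ord1 invr1 mul1r.
apply: new_cvg => //.
- exact: nearW.
- by move=> n _; exact: Eeps.
(* The assumption at the new location concerns the predictor of [z], and [posterior_yE] transfers it
   to that of [y]. The leave-one-out assumption is already about the predictor of [y]. *)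
move=> g; rewrite (_ : (fun n => _) = (fun n => E1 g n)); first exact: E1_cvg.
apply/funext => n; rewrite big_ord1 invr1 mul1e /E1; congr expectation.
apply/funext => om; rewrite posterior_yE// => i; exact: Ds.
Qed.
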